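(* The category $\mathcal{F}_\pi$, with the exact sequences specified in the context, is a Frobenius category (i.e. an exact category with enough projectives and enough injectives in which projective and injective objects coincide).
   Context: $R$ is a discrete valuation ring with uniformizing parameter $t$ (a fixed generator of the maximal ideal). $S^1=\mathbb{R}/2\pi\mathbb{Z}$, and for $x\in\mathbb{R}$ the class of $x$ in $S^1$ is $[x]$. A representation $V$ of $S^1$ over $R$ consists of an $R$-module $V[x]$ for every $[x]\in S^1$ and an $R$-linear map $V^{(x,\alpha)}:V[x]\to V[x-\alpha]$ for every $[x]\in S^1$ and real $\alpha\ge 0$ (depending only on $[x]$ and $\alpha$), such that $V^{(x-\beta,\alpha)}\circ V^{(x,\beta)}=V^{(x,\alpha+\beta)}$ for all $\alpha,\beta\ge 0$, and $V^{(x,2\pi n)}:V[x]\to V[x]$ is multiplication by $t^n$ for all $n\in\mathbb{N}$. A morphism $f:V\to W$ is a family of $R$-linear maps $f_{[x]}:V[x]\to W[x]$ with $W^{(x,\alpha)}f_{[x]}=f_{[x-\alpha]}V^{(x,\alpha)}$. Monomorphisms, epimorphisms, exactness and direct sums are taken pointwise; a representation is projective if morphisms from it lift through all epimorphisms. $P_{[x]}$ is the representation with $P_{[x]}[x-\alpha]=Re_x^\alpha$ free on one generator $e_x^\alpha$ for $0\le\alpha<2\pi$; for $n\in\mathbb{N}$ put $e_x^{\gamma+2\pi n}:=t^ne_x^\gamma$; the structure maps are $P_{[x]}^{(x-\alpha,\beta)}(e_x^\alpha)=e_x^{\alpha+\beta}$. A representation is finitely generated if it is a quotient of a finite direct sum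 of representations $P_{[x_i]}$. $\mathcal{P}_{S^1}$ is the category of all finitely generated projective representations of $S^1$ over $R$. The category $\mathcal{F}_\pi$: objects are pairs $(V,d)$ with $V\in\mathcal{P}_{S^1}$ and $d:V\to V$ an endomorphism with $d^2=t$ (multiplication by $t$); morphisms $(V,d)\to(W,d)$ are morphisms $f:V\to W$ with $fd=df$. Exact sequences in $\mathcal{F}_\pi$ are the sequences $(X,d)\xrightarrow{f}(Y,d)\xrightarrow{g}(Z,d)$ such that $0\to X\xrightarrow{f}Y\xrightarrow{g}Z\to 0$ is exact (hence split exact) in $\mathcal{P}_{S^1}$. *)

(* Defs.v *)
From HB Require Import structures.
From mathcomp Require Import all_boot all_order all_algebra.
From mathcomp Require Import ring_quotient boolp reals trigo.

Set Implicit Arguments.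
Unset Strict Implicit.
Unset Printing Implicit Defensive.

Import Order.TTheory GRing.Theory Num.Theory.
Local Open Scope ring_scope.
Local Open Scope quotient_scope.

Section DVR.
Variable R : idomainType.

Definition generated_by (a : R) (I : {pred R}) : Prop :=
  forall x, x \in I <-> exists b, x = b * a.

(* [idealr_closed] is the library's predicate for proper ideals. *)
Definition maximal_ideal (M : {pred R}) : Prop :=
  idealr_closed M /\
  forall I : {pred R}, idealr_closed I -> {subset M <= I} -> I =i M.

(* A local principal ideal domain that is not a field; the unit ideal, which
   [idealr_closed] leaves out, is principal anyway. *)
Definition discrete_valuation_ring : Prop :=
  (forall I : {pred R}, idealr_closed I -> exists a, generated_by a I) /\
  exists M : {pred R},
    [/\ maximal_ideal M,
        forall N : {pred R}, maximal_ideal N -> N =i M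
      & exists2 x, x \in M & x != 0].

Definition uniformizing_parameter (t : R) : Prop :=
  exists2 M : {pred R}, maximal_ideal M & generated_by t M.

End DVR.

Section Circle.
Variable K : realType.

Definition two_pi : K := 2 * pi.

Lemma two_pi_gt0 : 0 < two_pi.
Proof. by rewrite mulr_gt0 ?pi_gt0. Qed.

Lemma two_pi_neq0 : two_pi != 0.
Proof. by rewrite gt_eqF ?two_pi_gt0. Qed.

Definition periods : {pred K} := [pred x | x / two_pi \is a Num.int].

Lemma periods_zmod_closed : zmod_closed periods.
Proof.
split=> [|x y]; rewrite !inE ?mul0r ?rpred0 // => hx hy.
by rewrite mulrBl rpredB.
Qed.

HB.instance Definition _ := GRing.isZmodClosed.Build K periods
  periods_zmod_closed.

Definition S1 := {ideal_quot periods}.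
HB.instance Definition _ := GRing.Zmodule.on S1.

Definition cls (x : K) : S1 := \pi_{ideal_quot periods} x.

Lemma clsD x y : cls (x + y) = cls x + cls y.
Proof. by rewrite /cls raddfD. Qed.

Lemma clsN x : cls (- x) = - cls x.
Proof. by rewrite /cls raddfN. Qed.

Lemma cls_eq0 x : (cls x == 0) = (x / two_pi \is a Num.int).
Proof.
have -> : (0 : S1) = cls 0 by rewrite /cls raddf0.
by rewrite /cls -Quotient.idealrBE subr0.
Qed.

(* The angle [c] in [0, 2 pi[ with [y = x - [c]]; see [arcP]. *)
Definition arc (x y : S1) : K :=
  let r := repr (x - y : {ideal_quot periods}) in
  r - (Num.floor (r / two_pi))%:~R * two_pi.

Lemma arcP x y : 0 <= arc x y < two_pi /\ y = x - cls (arc x y).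
Proof.
rewrite /arc; set r := repr _; set n := Num.floor _; split.
  have /andP[] := floor_itv (r / two_pi); rewrite -/n.
  rewrite ler_pdivlMr ?two_pi_gt0 // ltr_pdivrMr ?two_pi_gt0 // => h1 h2.
  by rewrite subr_ge0 h1 ltrBlDr -[X in X + _]mul1r -mulrDl addrC -(intrD _ n 1).
have -> : cls (r - n%:~R * two_pi) = x - y.
  have <- : cls r = x - y by rewrite /cls reprK.
  rewrite /cls raddfB /= -[RHS]subr0; congr (_ - _); apply/eqP.
  by have := cls_eq0 (n%:~R * two_pi); rewrite mulfK ?two_pi_neq0 // => ->.
by rewrite opprB addrC subrK.
Qed.

Lemma arc_uniq x y c : 0 <= c < two_pi -> y = x - cls c -> arc x y = c.
Proof.
move=> /andP[c0 c1] exy; have [/andP[a0 a1]] := arcP x y; rewrite {1}exy.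
move=> /addrI/oppr_inj/eqP; rewrite -subr_eq0 -clsN -clsD cls_eq0.
set a := arc x y => /intrP[m hm].
suff m0 : m = 0.
  apply/esym/eqP; rewrite -subr_eq0; move: hm; rewrite m0 => /eqP.
  by rewrite mulf_eq0 invr_eq0 (negPf two_pi_neq0) orbF.
have : (`|m|%:~R : K) < 1.
  rewrite intr_norm -hm normrM normfV (gtr0_norm two_pi_gt0).
  rewrite ltr_pdivrMr ?two_pi_gt0 // mul1r ltr_norml; apply/andP; split.
    by rewrite ltrNl opprB (le_lt_trans _ a1) // gerBl.
  by rewrite (le_lt_trans _ c1) // gerBl.
rewrite (_ : 1 = 1%:~R) // ltr_int => h.
by apply/eqP; rewrite -normr_le0 -ltzD1.
Qed.

End Circle.

Section Representations.
Variables (K : realType) (R : idomainType) (t : R).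
Local Notation S1 := (S1 K).
Local Notation two_pi := (two_pi K).

(* The codomain index [y] of a structure map is kept separate from the equation
   [y = x - [a]], since [V (x - [b] - [a])] and [V (x - [a + b])] are not
   convertible.  The equation and [0 <= a] live in types with proof irrelevance,
   so the map depends on [x] and [a] only. *)
Record rep := Rep {
  rep_sort :> S1 -> lmodType R;
  rep_map : forall (x y : S1) (a : K), 0 <= a -> y = x - cls a ->
    {linear rep_sort x -> rep_sort y};
  rep_mapD : forall (x y z : S1) (a b : K) (ha : 0 <= a) (hb : 0 <= b)
      (hab : 0 <= a + b) (exy : y = x - cls b) (eyz : z = y - cls a)
      (exz : z = x - cls (a + b)) (v : rep_sort x),
    rep_map ha eyz (rep_map hb exy v) = rep_map hab exz v;
  rep_map_two_pi : forall (x : S1) (n : nat) (h : 0 <= two_pi * n%:R)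
      (e : x = x - cls (two_pi * n%:R)) (v : rep_sort x),
    rep_map h e v = t ^+ n *: v
}.

Record rep_hom (V W : rep) := RepHom {
  rep_fun :> forall x : S1, {linear V x -> W x};
  rep_hom_nat : forall (x y : S1) (a : K) (ha : 0 <= a) (e : y = x - cls a)
      (v : V x),
    rep_map W ha e (rep_fun x v) = rep_fun y (rep_map V ha e v)
}.

Lemma rep_homP (V W : rep) (f g : rep_hom V W) :
  (forall x v, f x v = g x v) -> f = g.
Proof.
case: f g => [f hf] [g hg] /= fg.
have E : f = g.
  apply: functional_extensionality_dep => x.
  case: (f x) (g x) (fg x) => [f0 [[A] [B]]] [g0 [[C] [D]]] /= E.
  have E0 : f0 = g0 by apply/funext.
  case: _ / E0 in C D E *.
  by rewrite (Prop_irrelevance A C) (Prop_irrelevance B D).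
by case: _ / E in hg fg *; rewrite (Prop_irrelevance hf hg).
Qed.

HB.instance Definition _ (V W : rep) := gen_eqMixin (rep_hom V W).
HB.instance Definition _ (V W : rep) := gen_choiceMixin (rep_hom V W).

Section HomZmod.
Variables V W : rep.
Implicit Types f g : rep_hom V W.

Fact rep_hom0_nat (x y : S1) (a : K) (ha : 0 <= a) (e : y = x - cls a) (v : V x) :
  rep_map W ha e ((\0 : {linear V x -> W x}) v) =
  (\0 : {linear V y -> W y}) (rep_map V ha e v).
Proof. by rewrite /= linear0. Qed.
Definition rep_hom0 : rep_hom V W := RepHom rep_hom0_nat.

Fact rep_homN_nat f (x y : S1) (a : K) (ha : 0 <= a) (e : y = x - cls a) (v : V x) :
  rep_map W ha e ((\- f x : {linear V x -> W x}) v) =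
  (\- f y : {linear V y -> W y}) (rep_map V ha e v).
Proof. by rewrite /= linearN rep_hom_nat. Qed.
Definition rep_homN f : rep_hom V W := RepHom (rep_homN_nat f).

Fact rep_homD_nat f g (x y : S1) (a : K) (ha : 0 <= a) (e : y = x - cls a)
    (v : V x) :
  rep_map W ha e ((f x \+ g x : {linear V x -> W x}) v) =
  (f y \+ g y : {linear V y -> W y}) (rep_map V ha e v).
Proof. by rewrite /= linearD !rep_hom_nat. Qed.
Definition rep_homD f g : rep_hom V W := RepHom (rep_homD_nat f g).

Fact rep_homDA : associative rep_homD.
Proof. by move=> f g h; apply: rep_homP => x v /=; rewrite addrA. Qed.
Fact rep_homDC : commutative rep_homD.
Proof. by move=> f g; apply: rep_homP => x v /=; rewrite addrC. Qed.
Fact rep_hom0D : left_id rep_hom0 rep_homD.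
Proof. by move=> f; apply: rep_homP => x v /=; rewrite add0r. Qed.
Fact rep_homND : left_inverse rep_hom0 rep_homN rep_homD.
Proof. by move=> f; apply: rep_homP => x v /=; rewrite addNr. Qed.

HB.instance Definition _ := GRing.isZmodule.Build (rep_hom V W)
  rep_homDA rep_homDC rep_hom0D rep_homND.
End HomZmod.

Fact rep_id_nat (V : rep) (x y : S1) (a : K) (ha : 0 <= a) (e : y = x - cls a)
    (v : V x) :
  rep_map V ha e ((idfun : {linear V x -> V x}) v) =
  (idfun : {linear V y -> V y}) (rep_map V ha e v).
Proof. by []. Qed.
Definition rep_id (V : rep) : rep_hom V V := RepHom (@rep_id_nat V).

Fact rep_comp_nat (U V W : rep) (g : rep_hom V W) (f : rep_hom U V)
    (x y : S1) (a : K) (ha : 0 <= a) (e : y = x - cls a) (v : U x) :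
  rep_map W ha e ((g x \o f x : {linear U x -> W x}) v) =
  (g y \o f y : {linear U y -> W y}) (rep_map U ha e v).
Proof. by rewrite /= !rep_hom_nat. Qed.
Definition rep_comp (U V W : rep) (g : rep_hom V W) (f : rep_hom U V) :
  rep_hom U W := RepHom (rep_comp_nat g f).

Definition rep_mono (V W : rep) (f : rep_hom V W) : Prop :=
  forall x, injective (f x).
Definition rep_epi (V W : rep) (f : rep_hom V W) : Prop :=
  forall x (w : W x), exists v, f x v = w.
Definition rep_exact (U V W : rep) (f : rep_hom U V) (g : rep_hom V W) : Prop :=
  forall x (v : V x), g x v = 0 <-> exists u, v = f x u.

Definition rep_short_exact (U V W : rep) (f : rep_hom U V) (g : rep_hom V W) :
  Prop := [/\ rep_mono f, rep_exact f g & rep_epi g].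

Definition rep_projective (V : rep) : Prop :=
  forall (A B : rep) (p : rep_hom A B) (f : rep_hom V B),
    rep_epi p -> exists g : rep_hom V A, rep_comp p g = f.

Section DirectSum.

Definition rep0_map (x y : S1) (a : K) (ha : 0 <= a) (e : y = x - cls a) :
  {linear 'rV[R]_0 -> 'rV[R]_0} := idfun.

Fact rep0_mapD (x y z : S1) (a b : K) (ha : 0 <= a) (hb : 0 <= b)
    (hab : 0 <= a + b) (exy : y = x - cls b) (eyz : z = y - cls a)
    (exz : z = x - cls (a + b)) v :
  rep0_map ha eyz (rep0_map hb exy v) = rep0_map hab exz v.
Proof. by []. Qed.

Fact rep0_map_two_pi (x : S1) (n : nat) (h : 0 <= two_pi * n%:R)
    (e : x = x - cls (two_pi * n%:R)) v :
  rep0_map h e v = t ^+ n *: v.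
Proof. by rewrite [LHS]thinmx0 [RHS]thinmx0. Qed.

Definition rep0 : rep :=
  @Rep (fun _ => 'rV[R]_0) rep0_map rep0_mapD rep0_map_two_pi.

Variables V W : rep.

Definition rep_sum_fun (x y : S1) (a : K) (ha : 0 <= a) (e : y = x - cls a)
  (v : V x * W x) : V y * W y := (rep_map V ha e v.1, rep_map W ha e v.2).

Fact rep_sum_fun_linear x y a ha e : linear (@rep_sum_fun x y a ha e).
Proof. by move=> k u v; rewrite /rep_sum_fun /= !linearP. Qed.

HB.instance Definition _ x y a ha e :=
  GRing.isLinear.Build R (V x * W x)%type (V y * W y)%type *:%R
    (@rep_sum_fun x y a ha e) (@rep_sum_fun_linear x y a ha e).

Definition rep_sum_map (x y : S1) (a : K) (ha : 0 <= a) (e : y = x - cls a) :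
  {linear (V x * W x)%type -> (V y * W y)%type} := @rep_sum_fun x y a ha e.

Fact rep_sum_mapD (x y z : S1) (a b : K) (ha : 0 <= a) (hb : 0 <= b)
    (hab : 0 <= a + b) (exy : y = x - cls b) (eyz : z = y - cls a)
    (exz : z = x - cls (a + b)) v :
  rep_sum_map ha eyz (rep_sum_map hb exy v) = rep_sum_map hab exz v.
Proof.
by rewrite /rep_sum_map /= /rep_sum_fun /= !(rep_mapD _ _ hab _ _ exz).
Qed.

Fact rep_sum_map_two_pi (x : S1) (n : nat) (h : 0 <= two_pi * n%:R)
    (e : x = x - cls (two_pi * n%:R)) v :
  rep_sum_map h e v = t ^+ n *: v.
Proof. by case: v => v w; congr pair => /=; rewrite rep_map_two_pi. Qed.

Definition rep_sum : rep :=
  @Rep (fun x => (V x * W x)%type) rep_sum_map rep_sum_mapD rep_sum_map_two_pi.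

End DirectSum.

Section Generator.
Variable x : S1.

(* [Prep] is [P_[x]].  It has the module [R] at every point [y], with basis the generator
   [e_x^(arc x y)] represented by [1].  For arbitrary [c >= 0] the element
   [e_x^c] is [t ^ n] times the basis of the module at [x - [c]], where [n] is
   the number of full turns in [c]. *)
Definition turns (c : K) : nat := Num.truncn (c / two_pi).
Definition Pgen (c : K) : R^o := t ^+ turns c.

(* The linear map sending the basis element [e_x^(arc x y)] to
   [e_x^(arc x y + b)]. *)
Definition Pmap (y z : S1) (b : K) (hb : 0 <= b) (e : z = y - cls b) :
  {linear R^o -> R^o} := *:%R (Pgen (arc x y + b)).

Lemma arcD (y z : S1) (b : K) : 0 <= b -> z = y - cls b ->
  arc x y + b = arc x z + two_pi * (turns (arc x y + b))%:R.
Proof.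
move=> hb e; have [/andP[a0 _] ey] := arcP x y.
have tp := two_pi_gt0 K.
set c := arc x y + b; have c0 : 0 <= c by rewrite addr_ge0.
apply/eqP; rewrite -subr_eq eq_sym; apply/eqP/arc_uniq.
  have /andP[] := truncn_itv (divr_ge0 c0 (ltW tp)); rewrite -/(turns c).
  rewrite ler_pdivlMr // ltr_pdivrMr // mulrC => h1.
  by rewrite -natr1 mulrDl mul1r mulrC subr_ge0 h1 ltrBlDr addrC.
rewrite clsD clsN [cls (two_pi * _)](_ : _ = 0); last first.
  by apply/eqP; rewrite cls_eq0 mulrAC mulfV ?gt_eqF // mul1r natr_int.
by rewrite subr0 /c clsD opprD addrA -ey.
Qed.

Lemma turnsD (c : K) (n : nat) : 0 <= c ->
  turns (c + two_pi * n%:R) = (turns c + n)%N.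
Proof.
move=> c0; have tp := two_pi_gt0 K.
rewrite /turns mulrDl mulrAC mulfV ?gt_eqF // mul1r addrC.
rewrite truncnD ?natr_nat //; first by rewrite natrK addnC.
by rewrite nnegrE divr_ge0 // ltW.
Qed.

Lemma turns_arc (y : S1) : turns (arc x y) = 0%N.
Proof.
have [/andP[a0 a1] _] := arcP x y; have tp := two_pi_gt0 K.
apply: truncn_def; apply/andP; split; first by rewrite divr_ge0 // ltW.
by rewrite ltr_pdivrMr // mul1r.
Qed.

Fact PmapD (y z w : S1) (a b : K) (ha : 0 <= a) (hb : 0 <= b)
    (hab : 0 <= a + b) (eyz : z = y - cls b) (ezw : w = z - cls a)
    (eyw : w = y - cls (a + b)) v :
  Pmap ha ezw (Pmap hb eyz v) = Pmap hab eyw v.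
Proof.
rewrite /= scalerA /Pgen; congr (_ *: _); rewrite -exprD; congr (_ ^+ _).
have [/andP[a0 _] _] := arcP x z.
have -> : arc x y + (a + b) =
    arc x z + a + two_pi * (turns (arc x y + b))%:R.
  by rewrite [RHS]addrAC -(arcD hb eyz) [a + b]addrC addrA.
by rewrite turnsD // addr_ge0.
Qed.

Fact Pmap_two_pi (y : S1) (n : nat) (h : 0 <= two_pi * n%:R)
    (e : y = y - cls (two_pi * n%:R)) v :
  Pmap h e v = t ^+ n *: v.
Proof.
have [/andP[a0 _] _] := arcP x y.
by rewrite /= /Pgen turnsD // turns_arc.
Qed.

Definition Prep : rep := @Rep (fun _ => R^o) Pmap PmapD Pmap_two_pi.

(* [Pgen_arc], [PgenD] and [rep_map_Pgen] are the defining relations of the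
   generators [e_x^c]. *)
Lemma Pgen_arc (y : S1) : Pgen (arc x y) = 1.
Proof. by rewrite /Pgen turns_arc. Qed.

Lemma PgenD (c : K) (n : nat) : 0 <= c ->
  Pgen (c + two_pi * n%:R) = t ^+ n *: Pgen c.
Proof. by move=> c0; rewrite /Pgen turnsD // addnC exprD. Qed.

Lemma rep_map_Pgen (c b : K) (y z : S1) (hb : 0 <= b) (e : z = y - cls b) :
  0 <= c -> y = x - cls c ->
  rep_map Prep hb e (Pgen c : Prep y) = Pgen (c + b).
Proof.
move=> c0 ey; have x0 : x = x - cls 0.
  by rewrite -[in RHS](subrr 0) clsD clsN subrr subr0.
have [/andP[a0 _] _] := arcP x y.
have xx : arc x x = 0.
  by apply: arc_uniq => //; rewrite lexx two_pi_gt0.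
have := arcD c0 ey; rewrite xx add0r => E.
have -> : c + b = arc x y + b + two_pi * (turns c)%:R by rewrite {1}E addrAC.
have ab0 : 0 <= arc x y + b by apply: addr_ge0.
rewrite (PgenD _ ab0); exact: (@mulrC R).
Qed.

End Generator.

(* The [foldr] is the direct sum of the [P_[x]] for [x] in [s], repetitions
   allowed. *)
Definition finitely_generated (V : rep) : Prop :=
  exists (s : seq S1)
    (p : rep_hom (foldr (fun x W => rep_sum (Prep x) W) rep0 s) V), rep_epi p.

Record fg_proj := FgProj {
  fg_proj_rep :> rep;
  fg_projFG : finitely_generated fg_proj_rep;
  fg_projP : rep_projective fg_proj_rep
}.

End Representations.

Record preadditive := Preadditive {
  obj :> Type;
  hom : obj -> obj -> zmodType;
  idm : forall X, hom X X;
  compm : forall X Y Z, hom Y Z -> hom X Y -> hom X Z;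
  compmA : forall X Y Z W (h : hom Z W) (g : hom Y Z) (f : hom X Y),
    compm h (compm g f) = compm (compm h g) f;
  comp1m : forall X Y (f : hom X Y), compm (idm Y) f = f;
  compm1 : forall X Y (f : hom X Y), compm f (idm X) = f;
  compmDl : forall X Y Z (g g' : hom Y Z) (f : hom X Y),
    compm (g + g') f = compm g f + compm g' f;
  compmDr : forall X Y Z (g : hom Y Z) (f f' : hom X Y),
    compm g (f + f') = compm g f + compm g f'
}.
Arguments idm {p} X.
Arguments compm {p X Y Z} g f.

Section ExactCategories.
Variable C : preadditive.
Local Notation "g \c f" := (compm g f) (at level 40, left associativity).

Definition iso (X Y : C) (f : hom X Y) : Prop :=
  exists g : hom Y X, g \c f = idm X /\ f \c g = idm Y.

Definition zero_object (Z : C) : Prop :=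
  forall X : C, (forall f : hom X Z, f = 0) /\ (forall f : hom Z X, f = 0).

Definition biproduct (X Y Z : C) (i1 : hom X Z) (i2 : hom Y Z)
    (p1 : hom Z X) (p2 : hom Z Y) : Prop :=
  [/\ p1 \c i1 = idm X, p2 \c i2 = idm Y, p1 \c i2 = 0, p2 \c i1 = 0
    & i1 \c p1 + i2 \c p2 = idm Z].

Definition additive_category : Prop :=
  (exists Z : C, zero_object Z) /\
  (forall X Y : C, exists (Z : C) (i1 : hom X Z) (i2 : hom Y Z)
     (p1 : hom Z X) (p2 : hom Z Y), biproduct i1 i2 p1 p2).

Definition is_kernel (X Y Z : C) (f : hom X Y) (g : hom Y Z) : Prop :=
  g \c f = 0 /\
  forall (W : C) (h : hom W Y), g \c h = 0 -> exists! k : hom W X, f \c k = h.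

Definition is_cokernel (X Y Z : C) (f : hom X Y) (g : hom Y Z) : Prop :=
  g \c f = 0 /\
  forall (W : C) (h : hom Y W), h \c f = 0 -> exists! k : hom Z W, k \c g = h.

Definition is_pushout (X Y X' Y' : C) (i : hom X Y) (f : hom X X')
    (i' : hom X' Y') (f' : hom Y Y') : Prop :=
  f' \c i = i' \c f /\
  forall (W : C) (u : hom Y W) (v : hom X' W), u \c i = v \c f ->
    exists! k : hom Y' W, k \c f' = u /\ k \c i' = v.

Definition is_pullback (Y Z Y' Z' : C) (p : hom Y Z) (f : hom Z' Z)
    (p' : hom Y' Z') (f' : hom Y' Y) : Prop :=
  p \c f' = f \c p' /\
  forall (W : C) (u : hom W Y) (v : hom W Z'), p \c u = f \c v ->
    exists! k : hom W Y', f' \c k = u /\ p' \c k = v.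

Variable E : forall X Y Z : C, hom X Y -> hom Y Z -> Prop.

Definition adm_mono (X Y : C) (i : hom X Y) : Prop :=
  exists (Z : C) (p : hom Y Z), E i p.
Definition adm_epi (Y Z : C) (p : hom Y Z) : Prop :=
  exists (X : C) (i : hom X Y), E i p.

(* Quillen's axioms, for a class [E] of kernel-cokernel pairs. *)
Record exact_category : Prop := ExactCategory {
  exact_additive : additive_category;
  exact_ker_coker : forall (X Y Z : C) (i : hom X Y) (p : hom Y Z),
    E i p -> is_kernel i p /\ is_cokernel i p;
  exact_iso : forall (X Y Z X' Y' Z' : C) (i : hom X Y) (p : hom Y Z)
      (i' : hom X' Y') (p' : hom Y' Z')
      (a : hom X X') (b : hom Y Y') (c : hom Z Z'),
    iso a -> iso b -> iso c -> b \c i = i' \c a -> c \c p = p' \c b ->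
    E i p -> E i' p';
  exact_mono1 : forall X : C, adm_mono (idm X);
  exact_epi1 : forall X : C, adm_epi (idm X);
  exact_mono_comp : forall (X Y Z : C) (i : hom X Y) (j : hom Y Z),
    adm_mono i -> adm_mono j -> adm_mono (j \c i);
  exact_epi_comp : forall (X Y Z : C) (p : hom X Y) (q : hom Y Z),
    adm_epi p -> adm_epi q -> adm_epi (q \c p);
  exact_pushout : forall (X Y X' : C) (i : hom X Y) (f : hom X X'),
    adm_mono i -> exists (Y' : C) (i' : hom X' Y') (f' : hom Y Y'),
      is_pushout i f i' f' /\ adm_mono i';
  exact_pullback : forall (Y Z Z' : C) (p : hom Y Z) (f : hom Z' Z),
    adm_epi p -> exists (Y' : C) (p' : hom Y' Z') (f' : hom Y' Y),
      is_pullback p f p' f' /\ adm_epi p'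
}.

Definition projective (X : C) : Prop :=
  forall (Y Z : C) (p : hom Y Z) (f : hom X Z),
    adm_epi p -> exists g : hom X Y, p \c g = f.

Definition injective_object (X : C) : Prop :=
  forall (Y Z : C) (i : hom Y Z) (f : hom Y X),
    adm_mono i -> exists g : hom Z X, g \c i = f.

Definition enough_projectives : Prop :=
  forall X : C, exists (Q : C) (p : hom Q X), projective Q /\ adm_epi p.

Definition enough_injectives : Prop :=
  forall X : C, exists (I : C) (i : hom X I), injective_object I /\ adm_mono i.

Record frobenius_category : Prop := FrobeniusCategory {
  frobenius_exact : exact_category;
  frobenius_enough_proj : enough_projectives;
  frobenius_enough_inj : enough_injectives;
  frobenius_proj_inj : forall X : C, projective X <-> injective_object X
}.

End ExactCategories.

Section Fpi.
Variables (K : realType) (R : idomainType) (t : R).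

Record Fobj := FObj {
  Fobj_proj :> fg_proj K t;
  Fd : rep_hom Fobj_proj Fobj_proj;
  Fd_sq : forall x (v : Fobj_proj x), Fd x (Fd x v) = t *: v
}.

Definition commutes_with_d (X Y : Fobj) : {pred rep_hom X Y} :=
  [pred f : rep_hom X Y | rep_comp f (Fd X) == rep_comp (Fd Y) f].

Lemma commutes_with_d_zmod_closed (X Y : Fobj) :
  zmod_closed (@commutes_with_d X Y).
Proof.
split=> [|f g]; rewrite !inE.
  by apply/eqP/rep_homP => x v /=; rewrite linear0.
move=> /eqP hf /eqP hg; apply/eqP/rep_homP => x v /=.
rewrite linearB /=.
have /= -> := congr1 (fun h : rep_hom X Y => h x v) hf.
by have /= -> := congr1 (fun h : rep_hom X Y => h x v) hg.
Qed.

HB.instance Definition _ (X Y : Fobj) :=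
  GRing.isZmodClosed.Build (rep_hom X Y) (@commutes_with_d X Y)
    (@commutes_with_d_zmod_closed X Y).

Record Fhom (X Y : Fobj) := FHom {
  Fhom_rep :> rep_hom X Y;
  Fhom_comm : Fhom_rep \in @commutes_with_d X Y
}.

HB.instance Definition _ (X Y : Fobj) := [isSub for @Fhom_rep X Y].
HB.instance Definition _ (X Y : Fobj) := [Choice of Fhom X Y by <:].
HB.instance Definition _ (X Y : Fobj) :=
  [SubChoice_isSubZmodule of Fhom X Y by <:].

Fact Fid_comm (X : Fobj) : rep_id X \in @commutes_with_d X X.
Proof. by rewrite inE; apply/eqP/rep_homP. Qed.
Definition Fid (X : Fobj) : Fhom X X := FHom (Fid_comm X).

Fact Fcomp_comm (X Y Z : Fobj) (g : Fhom Y Z) (f : Fhom X Y) :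
  rep_comp g f \in @commutes_with_d X Z.
Proof.
rewrite inE; apply/eqP/rep_homP => x v /=.
have /eqP hf := Fhom_comm f; have /eqP hg := Fhom_comm g.
have /= -> := congr1 (fun h : rep_hom X Y => h x v) hf.
by have /= -> := congr1 (fun h : rep_hom Y Z => h x (f x v)) hg.
Qed.
Definition Fcomp (X Y Z : Fobj) (g : Fhom Y Z) (f : Fhom X Y) : Fhom X Z :=
  FHom (Fcomp_comm g f).

Lemma FhomP (X Y : Fobj) (f g : Fhom X Y) :
  (forall x v, f x v = g x v) -> f = g.
Proof. by move=> fg; apply/val_inj/rep_homP. Qed.

Fact FcompA (X Y Z W : Fobj) (h : Fhom Z W) (g : Fhom Y Z) (f : Fhom X Y) :
  Fcomp h (Fcomp g f) = Fcomp (Fcomp h g) f.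
Proof. exact: FhomP. Qed.
Fact Fcomp1m (X Y : Fobj) (f : Fhom X Y) : Fcomp (Fid Y) f = f.
Proof. exact: FhomP. Qed.
Fact Fcompm1 (X Y : Fobj) (f : Fhom X Y) : Fcomp f (Fid X) = f.
Proof. exact: FhomP. Qed.
Fact FcompDl (X Y Z : Fobj) (g g' : Fhom Y Z) (f : Fhom X Y) :
  Fcomp (g + g') f = Fcomp g f + Fcomp g' f.
Proof. exact: FhomP. Qed.
Fact FcompDr (X Y Z : Fobj) (g : Fhom Y Z) (f f' : Fhom X Y) :
  Fcomp g (f + f') = Fcomp g f + Fcomp g f'.
Proof. by apply: FhomP => x v /=; rewrite linearD. Qed.

Definition Fpi : preadditive :=
  @Preadditive Fobj Fhom Fid Fcomp FcompA Fcomp1m Fcompm1 FcompDl FcompDr.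

Definition Fpi_exact (X Y Z : Fpi) (f : hom X Y) (g : hom Y Z) : Prop :=
  rep_short_exact (f : Fhom X Y) (g : Fhom Y Z).

End Fpi.

(* Main.v *)
Require Import Defs.
From HB Require Import structures.
From mathcomp Require Import all_boot all_order all_algebra.
From mathcomp Require Import boolp reals.

Set Implicit Arguments.
Unset Strict Implicit.
Unset Printing Implicit Defensive.

Import GRing.Theory.
Local Open Scope ring_scope.

(** The reason for the theorem is that a short exact sequence of finitely
generated projective representations splits, and that the forgetful functor
from pairs [(V, d)] to representations has one functor, [double], as left and
as right adjoint.

Exactness.  By splitting ([short_exact_split]), the middle term of an exact
sequence is, as a representation, the direct sum of the outer ones, and such
sums are again finitely generated projective.  So the object required by each
of Quillen's axioms is already known as a representation: the cokernel of a
composite of admissible monomorphisms is the sum of the two cokernels, the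
pushout of [X -> Y] along [X -> X'] is [X'] plus the cokernel of [X -> Y], and
dually.  What remains is to find [d] on it.  In each case the representation is
the cokernel of a morphism of pairs, or the kernel of one, so there is only one
possible [d], the induced one, and its square is [t] because that holds on the
pair above or below it ([coker_d], [ker_d]).  For the pushout the morphism is
[(- f, i) : X -> X' + Y], so that the universal property is that of a cokernel.

Frobenius property.  [double V] is [V + V] with [d (a, b) = (t b, a)].
Morphisms [double V -> (X, d)] correspond to morphisms [f : V -> X], by
[(a, b) |-> f a + d (f b)], and morphisms [(X, d) -> double V] to morphisms
[f : X -> V], by [v |-> (f (d v), f v)].  As admissible epimorphisms and
monomorphisms split as morphisms of representations, [double V] is both
projective and injective.  For [f] the identity of [X], these morphisms are an
admissible epimorphism [double X -> (X, d)] with kernel [(X, - d)] and an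
admissible monomorphism [(X, d) -> double X] with cokernel [(X, - d)].  Hence
there are enough projectives and injectives, and a projective or injective
object, being a retract of some [double X], is also of the other kind. *)

(** * Direct sums of representations *)

Section DirectSums.
Variables (K : realType) (R : idomainType) (t : R).
Local Notation rep := (rep K t).

Fact rep_fst_nat (V W : rep) (x y : S1 K) (a : K) (ha : 0 <= a)
    (e : y = x - cls a) (v : rep_sum V W x) :
  rep_map V ha e ((fst : {linear rep_sum V W x -> V x}) v) =
  (fst : {linear rep_sum V W y -> V y}) (rep_map (rep_sum V W) ha e v).
Proof. by []. Qed.
Definition rep_fst (V W : rep) : rep_hom (rep_sum V W) V :=
  RepHom (@rep_fst_nat V W).

Fact rep_snd_nat (V W : rep) (x y : S1 K) (a : K) (ha : 0 <= a)
    (e : y = x - cls a) (v : rep_sum V W x) :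
  rep_map W ha e ((snd : {linear rep_sum V W x -> W x}) v) =
  (snd : {linear rep_sum V W y -> W y}) (rep_map (rep_sum V W) ha e v).
Proof. by []. Qed.
Definition rep_snd (V W : rep) : rep_hom (rep_sum V W) W :=
  RepHom (@rep_snd_nat V W).

Section Pair.
Variables (U V W : rep) (f : rep_hom U V) (g : rep_hom U W).

Definition rep_pair_fun x (u : U x) : rep_sum V W x := (f x u, g x u).

Fact rep_pair_linear x : linear (@rep_pair_fun x).
Proof. by move=> k u v; rewrite /rep_pair_fun !linearP. Qed.
HB.instance Definition _ x :=
  GRing.isLinear.Build R (U x) (rep_sum V W x) *:%R (@rep_pair_fun x)
    (@rep_pair_linear x).

Fact rep_pair_nat (x y : S1 K) (a : K) (ha : 0 <= a) (e : y = x - cls a)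
    (u : U x) :
  rep_map (rep_sum V W) ha e
    ((@rep_pair_fun x : {linear U x -> rep_sum V W x}) u) =
  (@rep_pair_fun y : {linear U y -> rep_sum V W y}) (rep_map U ha e u).
Proof. by rewrite /= /rep_sum_fun /rep_pair_fun /= !rep_hom_nat. Qed.
Definition rep_pair : rep_hom U (rep_sum V W) := RepHom rep_pair_nat.
End Pair.

Definition rep_copair (U V W : rep) (f : rep_hom U W) (g : rep_hom V W) :
  rep_hom (rep_sum U V) W :=
  rep_comp f (rep_fst U V) + rep_comp g (rep_snd U V).

Definition rep_inl (V W : rep) : rep_hom V (rep_sum V W) :=
  rep_pair (rep_id V) 0.
Definition rep_inr (V W : rep) : rep_hom W (rep_sum V W) :=
  rep_pair 0 (rep_id W).

Lemma rep_sum_projective (V W : rep) :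
  rep_projective V -> rep_projective W -> rep_projective (rep_sum V W).
Proof.
move=> pV pW A B p f ep.
have [g hg] := pV _ _ p (rep_comp f (rep_inl V W)) ep.
have [h hh] := pW _ _ p (rep_comp f (rep_inr V W)) ep.
exists (rep_copair g h); apply: rep_homP => x [v w] /=.
rewrite linearD /=.
have /= -> := congr1 (fun k : rep_hom V B => k x v) hg.
have /= -> := congr1 (fun k : rep_hom W B => k x w) hh.
by rewrite -linearD /= /rep_pair_fun /=; congr (f x (_, _)); rewrite ?addr0 ?add0r.
Qed.

Lemma rep0_projective : rep_projective (rep0 K t).
Proof.
move=> A B p f _; exists 0; apply: rep_homP => x v /=.
by rewrite (thinmx0 v) !linear0.
Qed.

Local Notation Psum :=
  (foldr (fun x (W : rep) => rep_sum (Prep t x) W) (rep0 K t)).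

(** This is what makes generators of [V] followed by generators of [W] into
generators of [V + W]. *)
Lemma rep_epi_cat (s1 s2 : seq (S1 K)) :
  exists p : rep_hom (Psum (s1 ++ s2)) (rep_sum (Psum s1) (Psum s2)), rep_epi p.
Proof.
elim: s1 => [|z s1 [p ep]] /=.
  exists (rep_inr _ _) => x [v w]; exists w => /=.
  by rewrite /rep_pair_fun (thinmx0 v).
pose q := rep_comp p (rep_snd (Prep t z) (Psum (s1 ++ s2))).
exists (rep_pair (rep_pair (rep_fst _ _) (rep_comp (rep_fst _ _) q))
          (rep_comp (rep_snd _ _) q)) => x [[c v] w].
have [u hu] := ep x (v, w).
by exists (c, u); rewrite /= /rep_pair_fun /= /rep_pair_fun /= hu.
Qed.

Lemma rep_sum_fg (V W : rep) : finitely_generated V -> finitely_generated W ->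
  finitely_generated (rep_sum V W).
Proof.
move=> [s [p ep]] [r [q eq]]; exists (s ++ r).
have [c ec] := rep_epi_cat s r.
exists (rep_comp (rep_pair (rep_comp p (rep_fst _ _)) (rep_comp q (rep_snd _ _))) c).
move=> x [v w]; have [v' hv] := ep x v; have [w' hw] := eq x w.
have [u hu] := ec x (v', w').
by exists u; rewrite /= hu /rep_pair_fun /= hv hw.
Qed.

Lemma rep0_fg : finitely_generated (rep0 K t).
Proof. by exists [::], (rep_id _) => x w; exists w. Qed.

Definition proj0 : fg_proj K t := FgProj rep0_fg rep0_projective.
Definition proj_sum (V W : fg_proj K t) : fg_proj K t :=
  FgProj (rep_sum_fg (fg_projFG V) (fg_projFG W))
    (rep_sum_projective (@fg_projP _ _ _ V) (@fg_projP _ _ _ W)).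

End DirectSums.

(** * Splitting of short exact sequences *)

Section Splitting.
Variables (K : realType) (R : idomainType) (t : R).
Local Notation rep := (rep K t).

(** A morphism whose values lie in the image of a monomorphism [i] factors
through [i]; the preimages, chosen pointwise, are compatible because [i] is
injective. *)
Section Factor.
Variables (U V W : rep) (i : rep_hom U V) (f : rep_hom W V).
Hypothesis i_mono : rep_mono i.
Hypothesis f_im : forall x w, exists u, f x w = i x u.

Definition factor_fun x (w : W x) : U x := projT1 (cid (f_im w)).

Lemma factor_funE x w : i x (factor_fun w) = f x w.
Proof. by rewrite /factor_fun; case: cid => u /= ->. Qed.

Fact factor_linear x : linear (@factor_fun x).
Proof.
by move=> k u v; apply: i_mono; rewrite linearP !factor_funE linearP.
Qed.
HB.instance Definition _ x :=
  GRing.isLinear.Build R (W x) (U x) *:%R (@factor_fun x) (@factor_linear x).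

Fact factor_nat (x y : S1 K) (a : K) (ha : 0 <= a) (e : y = x - cls a)
    (w : W x) :
  rep_map U ha e ((@factor_fun x : {linear W x -> U x}) w) =
  (@factor_fun y : {linear W y -> U y}) (rep_map W ha e w).
Proof.
by apply: i_mono; rewrite -rep_hom_nat /= !factor_funE rep_hom_nat.
Qed.
Definition factor : rep_hom W U := RepHom factor_nat.

End Factor.

Lemma short_exact0 (U V W : rep) (i : rep_hom U V) (p : rep_hom V W) :
  rep_short_exact i p -> forall x u, p x (i x u) = 0.
Proof. by case=> _ ex _ x u; apply/ex; exists u. Qed.

(** The section [s] lifts the identity through [p], and [v - s (p v)] lies in the
kernel of [p], hence comes from [U]; this defines the retraction [r]. *)
Lemma short_exact_split (U V W : rep) (i : rep_hom U V) (p : rep_hom V W) :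
  rep_projective W -> rep_short_exact i p ->
  exists (s : rep_hom W V) (r : rep_hom V U),
    [/\ forall x w, p x (s x w) = w, forall x u, r x (i x u) = u,
        forall x w, r x (s x w) = 0
      & forall x v, v = i x (r x v) + s x (p x v)].
Proof.
move=> pW ip; have ip0 := short_exact0 ip; case: ip => mi ex ep.
have [s hs] := pW _ _ p (rep_id W) ep.
have {hs} ps x w : p x (s x w) = w.
  exact: (congr1 (fun k : rep_hom W W => k x w) hs).
have im x v : exists u, (rep_id V - rep_comp s p) x v = i x u.
  by apply/ex; rewrite linearB /= ps subrr.
have rE x v : i x (factor mi im x v) = v - s x (p x v).
  exact: (factor_funE im).
exists s, (factor mi im); split=> // [x u | x w | x v]; last by rewrite rE subrK.
  by apply: (mi x); rewrite rE ip0 linear0 subr0.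
by apply: (mi x); rewrite rE ps subrr linear0.
Qed.

End Splitting.

(** * Pairs with a square root of t *)

Section Objects.
Variables (K : realType) (R : idomainType) (t : R).
Local Notation Fobj := (@Fobj K R t).

Lemma Fhom_d (X Y : Fobj) (f : Fhom X Y) x v :
  f x (Fd X x v) = Fd Y x (f x v).
Proof.
have /eqP h := Fhom_comm f.
exact: (congr1 (fun k : rep_hom X Y => k x v) h).
Qed.

Fact mkFhom_comm (X Y : Fobj) (f : rep_hom X Y)
    (fd : forall x v, f x (Fd X x v) = Fd Y x (f x v)) :
  f \in @commutes_with_d _ _ _ X Y.
Proof. by rewrite inE; apply/eqP/rep_homP. Qed.
Definition mkFhom (X Y : Fobj) (f : rep_hom X Y) fd : Fhom X Y :=
  FHom (@mkFhom_comm X Y f fd).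

Definition Fzero : Fobj :=
  @FObj _ _ _ (proj0 K t) 0
    (fun x v => etrans (thinmx0 _) (esym (thinmx0 (t *: v)))).

Fact Fsum_sq (X Y : Fobj) x (v : proj_sum X Y x) (d := rep_pair
    (rep_comp (Fd X) (rep_fst X Y)) (rep_comp (Fd Y) (rep_snd X Y))) :
  d x (d x v) = t *: v.
Proof. by case: v => v w; rewrite /d /= /rep_pair_fun /= !Fd_sq. Qed.
Definition Fsum (X Y : Fobj) : Fobj := FObj (@Fsum_sq X Y).

Definition Ffst (X Y : Fobj) : Fhom (Fsum X Y) X :=
  @mkFhom (Fsum X Y) X (rep_fst X Y) (fun x v => erefl).
Definition Fsnd (X Y : Fobj) : Fhom (Fsum X Y) Y :=
  @mkFhom (Fsum X Y) Y (rep_snd X Y) (fun x v => erefl).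

Fact Fpair_comm (X Y Z : Fobj) (f : Fhom Z X) (g : Fhom Z Y) x (v : Z x) :
  rep_pair f g x (Fd Z x v) = Fd (Fsum X Y) x (rep_pair f g x v).
Proof. by rewrite /= /rep_pair_fun /= !Fhom_d. Qed.
Definition Fpair (X Y Z : Fobj) (f : Fhom Z X) (g : Fhom Z Y) :
  Fhom Z (Fsum X Y) := @mkFhom Z (Fsum X Y) (rep_pair f g) (Fpair_comm f g).

Definition Finl (X Y : Fobj) : Fhom X (Fsum X Y) := Fpair (Fid X) 0.
Definition Finr (X Y : Fobj) : Fhom Y (Fsum X Y) := Fpair 0 (Fid Y).

Fact Fneg_sq (X : Fobj) x (v : X x) : (- Fd X) x ((- Fd X) x v) = t *: v.
Proof. by rewrite /= linearN opprK Fd_sq. Qed.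
(** The pair [(X, - d)], which is the kernel of [double X -> (X, d)] and the
cokernel of [(X, d) -> double X]. *)
Definition Fneg (X : Fobj) : Fobj := FObj (@Fneg_sq X).

Fact rep_scale_nat (V : rep K t) (x y : S1 K) (a : K) (ha : 0 <= a)
    (e : y = x - cls a) (v : V x) :
  rep_map V ha e (( *:%R t : {linear V x -> V x}) v) =
  ( *:%R t : {linear V y -> V y}) (rep_map V ha e v).
Proof. by rewrite /= linearZ. Qed.
Definition rep_scale (V : rep K t) : rep_hom V V := RepHom (@rep_scale_nat V).

(** The endomorphism [(a, b) |-> (t b, a)]: the first summand stands for [V] and
the second for a formal [d V]. *)
Definition double_d (V : fg_proj K t) : rep_hom (proj_sum V V) (proj_sum V V) :=
  rep_pair (rep_comp (rep_scale V) (rep_snd V V)) (rep_fst V V).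

Fact double_sq (V : fg_proj K t) x (v : proj_sum V V x) :
  double_d V x (double_d V x v) = t *: v.
Proof. by case: v. Qed.
Definition double (V : fg_proj K t) : Fobj := FObj (@double_sq V).

Fact from_double_comm (V : fg_proj K t) (X : Fobj) (f : rep_hom V X) x
    (v : double V x) (g := rep_copair f (rep_comp (Fd X) f)) :
  g x (Fd (double V) x v) = Fd X x (g x v).
Proof. by case: v => a b; rewrite /g /= linearD Fd_sq linearZ addrC. Qed.
(** The morphism of pairs extending [f] along [V -> double V], by the left
adjunction of [double]. *)
Definition from_double (V : fg_proj K t) (X : Fobj) (f : rep_hom V X) :
  Fhom (double V) X := @mkFhom (double V) X _ (from_double_comm f).

Fact to_double_comm (V : fg_proj K t) (X : Fobj) (f : rep_hom X V) x
    (v : X x) (g := rep_pair (rep_comp f (Fd X)) f) :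
  g x (Fd X x v) = Fd (double V) x (g x v).
Proof. by rewrite /g /= /rep_pair_fun /= Fd_sq linearZ. Qed.
(** The morphism of pairs whose second component is [f], by the right
adjunction of [double]. *)
Definition to_double (V : fg_proj K t) (X : Fobj) (f : rep_hom X V) :
  Fhom X (double V) := @mkFhom X (double V) _ (to_double_comm f).

(** With a section [s] of [q], the induced endomorphism is [q d s]; it satisfies
[q d = (q d s) q] because [1 - s q] has values in the image of [i], which [d]
preserves and [q] kills.  The identity [d^2 = t] descends since [q] is onto. *)
Lemma coker_d (X Y : Fobj) (C : fg_proj K t) (i : Fhom X Y) (q : rep_hom Y C) :
  rep_short_exact i q ->
  exists d : rep_hom C C, (forall x v, d x (d x v) = t *: v) /\
    (forall x v, q x (Fd Y x v) = d x (q x v)).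
Proof.
move=> iq; have q0 := short_exact0 iq.
have [s [r [qs _ _ E]]] := short_exact_split (@fg_projP _ _ _ C) iq.
pose d := rep_comp q (rep_comp (Fd Y) s).
have qd x v : q x (Fd Y x v) = d x (q x v).
  by rewrite [in LHS](E x v) !linearD /= -Fhom_d q0 add0r.
exists d; split=> // x v.
by rewrite -[in LHS](qs x v) -!qd Fd_sq linearZ /= qs.
Qed.

(** Dually, with a retraction [r] of [i], the induced endomorphism is [r d i]. *)
Lemma ker_d (Y Z : Fobj) (C : fg_proj K t) (i : rep_hom C Y) (p : Fhom Y Z) :
  rep_short_exact i p ->
  exists d : rep_hom C C, (forall x v, d x (d x v) = t *: v) /\
    (forall x v, i x (d x v) = Fd Y x (i x v)).
Proof.
move=> ip; have p0 := short_exact0 ip.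
have [s [r [_ ri _ E]]] := short_exact_split (@fg_projP _ _ _ Z) ip.
pose d := rep_comp r (rep_comp (Fd Y) i).
have di x v : i x (d x v) = Fd Y x (i x v).
  by rewrite [RHS]E Fhom_d p0 !linear0 addr0.
exists d; split=> // x v; case: ip => mi _ _.
by apply: mi; rewrite !di Fd_sq linearZ.
Qed.

End Objects.

(** * The exact structure *)

Section Exactness.
Variables (K : realType) (R : idomainType) (t : R).
Local Notation Fobj := (Fobj K t).
Local Notation C := (Fpi K t).
Local Notation E := (@Fpi_exact K R t).

Lemma FhomE (X Y : Fobj) (f g : Fhom X Y) : f = g -> forall x v, f x v = g x v.
Proof. by move->. Qed.

Lemma exact_split (X Y Z : Fobj) (i : Fhom X Y) (p : Fhom Y Z) : E i p ->
  exists (s : rep_hom Z Y) (r : rep_hom Y X),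
    [/\ forall x w, p x (s x w) = w, forall x u, r x (i x u) = u,
        forall x w, r x (s x w) = 0
      & forall x v, v = i x (r x v) + s x (p x v)].
Proof. exact: short_exact_split (@fg_projP _ _ _ _). Qed.

(** A morphism killed by [p] factors through [i] as a morphism of
representations, and the factor commutes with [d] because [i] is a
monomorphism that does. *)
Lemma exact_is_kernel (X Y Z : Fobj) (i : Fhom X Y) (p : Fhom Y Z) :
  E i p -> @is_kernel C X Y Z i p.
Proof.
move=> ip; have p0 := short_exact0 ip; split.
  by apply: FhomP => x v; apply: p0.
case: ip => mi ex _ W h /FhomE ph0.
have him x w : exists u, (h : Fhom W Y) x w = i x u.
  by apply/ex/ph0.
have iE x w : i x (factor mi him x w) = (h : Fhom W Y) x w.
  exact: (factor_funE him).
have kd x w : factor mi him x (Fd W x w) = Fd X x (factor mi him x w).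
  by apply: (mi x); rewrite iE !Fhom_d iE.
exists (mkFhom kd); split=> [|k' /FhomE ik']; apply: FhomP => x w.
  exact: iE.
by apply: (mi x); exact: etrans (iE x w) (esym (ik' x w)).
Qed.

(** The factorisation of [h] is [h s] for a section [s] of [p].  In general [s]
does not commute with [d], but [h s] does: [h s p = h], and [p] is onto. *)
Lemma exact_is_cokernel (X Y Z : Fobj) (i : Fhom X Y) (p : Fhom Y Z) :
  E i p -> @is_cokernel C X Y Z i p.
Proof.
move=> ip; have p0 := short_exact0 ip; split.
  by apply: FhomP => x v; apply: p0.
have [s [r [ps _ _ EE]]] := exact_split ip => W h /FhomE hi0.
pose k := rep_comp (h : Fhom Y W) s.
have kp x v : k x (p x v) = (h : Fhom Y W) x v.
  by rewrite [in RHS](EE x v) linearD [X in _ = X + _]hi0 add0r.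
have kd x w : k x (Fd Z x w) = Fd W x (k x w).
  by rewrite -[w]ps -Fhom_d !kp Fhom_d.
exists (mkFhom kd); split=> [|k' /FhomE kp']; apply: FhomP => x w.
  exact: kp.
by rewrite -[w]ps; exact: etrans (kp x _) (esym (kp' x _)).
Qed.

Lemma Fpi_additive : additive_category C.
Proof.
split.
  exists (Fzero K t) => X; split=> f; apply: FhomP => x v.
    exact: etrans (thinmx0 _) (esym (thinmx0 _)).
  by rewrite (thinmx0 v) !linear0.
move=> X Y; exists (Fsum X Y), (Finl X Y), (Finr X Y), (Ffst X Y), (Fsnd X Y).
split; apply: FhomP => x //= [v w].
by rewrite /= /rep_pair_fun; congr pair; rewrite /= ?addr0 ?add0r.
Qed.

Lemma isoE (X Y : Fobj) (f : Fhom X Y) : @iso C X Y f ->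
  exists g : Fhom Y X, (forall x v, g x (f x v) = v) /\
    (forall x v, f x (g x v) = v).
Proof. by case=> g [/FhomE gf /FhomE fg]; exists g. Qed.

Lemma Fpi_exact_iso (X Y Z X' Y' Z' : Fobj) (i : Fhom X Y) (p : Fhom Y Z)
    (i' : Fhom X' Y') (p' : Fhom Y' Z')
    (a : Fhom X X') (b : Fhom Y Y') (c : Fhom Z Z') :
  @iso C X X' a -> @iso C Y Y' b -> @iso C Z Z' c ->
  Fcomp b i = Fcomp i' a -> Fcomp c p = Fcomp p' b -> E i p -> E i' p'.
Proof.
move=> /isoE[a' [a'a aa']] /isoE[b' [b'b bb']] /isoE[c' [c'c cc']].
move=> /FhomE/= bi /FhomE/= cp ip; have p0 := short_exact0 ip.
case: ip => mi ex ep; split=> [x u v uv|x v|x w].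
- rewrite -[u]aa' -[v]aa'; congr (a x _); apply: (mi x).
  by rewrite -[LHS]b'b -[RHS]b'b !bi !aa' uv.
- split=> [pv|[u ->]]; last by rewrite -[u]aa' -bi -cp p0 linear0.
  have /ex[u hu] : p x (b' x v) = 0.
    by rewrite -[LHS]c'c cp bb' pv linear0.
  by exists (a x u); rewrite -bi -hu bb'.
- have [v hv] := ep x (c' x w).
  by exists (b x v); rewrite -cp hv cc'.
Qed.

Lemma exact_id0 (X : Fobj) : E (Fid X) (0 : Fhom X (Fzero K t)).
Proof.
split=> [x u v //|x v|x w]; first by split=> // _; exists v.
by exists 0; exact: etrans (thinmx0 _) (esym (thinmx0 _)).
Qed.

Lemma exact_0id (X : Fobj) : E (0 : Fhom (Fzero K t) X) (Fid X).
Proof.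
split=> [x u v _|x v|x w]; last by exists w.
  exact: etrans (thinmx0 _) (esym (thinmx0 _)).
by split=> [e|[? ->]] //; exists 0; exact: e.
Qed.

(** With [Y] split off [Z], the cokernel of [j i] is the sum of the cokernels
of [i] and [j], by the map [(p1 r, p2)]. *)
Lemma adm_mono_comp (X Y Z : Fobj) (i : Fhom X Y) (j : Fhom Y Z) :
  @adm_mono C E X Y i -> @adm_mono C E Y Z j ->
  @adm_mono C E X Z (Fcomp j i).
Proof.
move=> [C1 [p1 ip]] [C2 [p2 jp]].
have p10 := short_exact0 ip; have p20 := short_exact0 jp.
have [s [r [ps rj r0 _]]] := exact_split jp.
pose q : rep_hom Z (proj_sum (C1 : Fobj) (C2 : Fobj)) :=
  rep_pair (rep_comp (p1 : Fhom _ _) r) (p2 : Fhom _ _).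
have ijq : rep_short_exact (Fcomp j i) q.
  case: ip jp => mi exi epi [mj exj epj]; split=> [x u v /mj/mi //|x v|x [c1 c2]].
    split=> [[p1v /exj[y vy]]|[u ->]].
      move: p1v; rewrite /= vy rj => /exi[u yu]; exists u.
      by rewrite /= -yu.
    by rewrite /= /rep_pair_fun /= rj p10 p20.
  have [y hy] := epi x c1; exists (j x y + s x c2).
  rewrite /= /rep_pair_fun /=; congr pair.
    by rewrite linearD rj r0 addr0.
  by rewrite linearD p20 ps add0r.
have [d [hd qd]] := coker_d ijq.
by exists (FObj hd), (@mkFhom _ _ _ Z (FObj hd) q qd).
Qed.

(** With [Y] lifted into [X] by [s], the kernel of [q p] is the sum of the
kernels of [p] and [q], by the map [i1 + s i2]. *)
Lemma adm_epi_comp (X Y Z : Fobj) (p : Fhom X Y) (q : Fhom Y Z) :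
  @adm_epi C E X Y p -> @adm_epi C E Y Z q ->
  @adm_epi C E X Z (Fcomp q p).
Proof.
move=> [K1 [i1 ip]] [K2 [i2 iq]].
have p0 := short_exact0 ip; have q0 := short_exact0 iq.
have [s [r [ps ri _ EE]]] := exact_split ip.
pose j : rep_hom (proj_sum (K1 : Fobj) (K2 : Fobj)) X :=
  rep_copair (i1 : Fhom _ _) (rep_comp s (i2 : Fhom _ _)).
have ijq : rep_short_exact j (Fcomp q p).
  case: ip iq => mi exi epi [mj exj epj]; split=> [x [a b] [a' b']|x v|x w].
  - rewrite /= => h.
    have hb : b = b'.
      apply: (mj x); have := congr1 (p x) h.
      by rewrite !linearD !p0 !ps !add0r.
    by move: h; rewrite hb => /addIr/mi ->.
  - split=> [/exj[b hb]|[[a b] ->]].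
      by exists (r x v, b); rewrite /= -hb -EE.
    by rewrite /= linearD p0 ps add0r q0.
  - have [y hy] := epj x w.
    by exists (s x y); rewrite /= ps.
have [d [hd qd]] := ker_d ijq.
by exists (FObj hd), (@mkFhom _ _ _ (FObj hd) X j qd).
Qed.

(** The pushout is the cokernel of [(- f, i) : X -> X' + Y].  Splitting [Y] as
[X + Z] identifies it with [X' + Z], the quotient map sending [(x', y)] to
[(x' + f (r y), p y)], so that the cokernel of [i'] is the second projection. *)
Lemma adm_mono_pushout (X Y X' : Fobj) (i : Fhom X Y) (f : Fhom X X') :
  @adm_mono C E X Y i ->
  exists (Y' : Fobj) (i' : Fhom X' Y') (f' : Fhom Y Y'),
    @is_pushout C X Y X' Y' i f i' f' /\ @adm_mono C E X' Y' i'.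
Proof.
move=> [Z [p ip]]; have p0 := short_exact0 ip.
have [s [r [ps ri _ EE]]] := exact_split ip.
pose u : Fhom X (Fsum X' Y) := Fpair (- f) i.
pose q : rep_hom (Fsum X' Y) (proj_sum X' (Z : Fobj)) :=
  rep_pair (rep_copair (rep_id X') (rep_comp f r))
    (rep_comp (p : Fhom _ _) (rep_snd _ _)).
have uq : rep_short_exact u q.
  case: ip => mi ex ep; split=> [x v w []|x [a b]|x [a c]].
  - by move=> _ /mi.
  - split=> [[h /ex[v hv]]|[v [-> ->]]].
      exists v; rewrite /= /rep_pair_fun /=; congr pair => //.
      by apply/eqP; rewrite -addr_eq0; move: h; rewrite /= hv ri => ->.
    by rewrite /= /rep_pair_fun /= ri p0 addNr.
  - have [b hb] := ep x c; exists (a - f x (r x b), b).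
    by rewrite /= /rep_pair_fun /= subrK hb.
have [d [hd qd]] := coker_d uq.
pose Y' := FObj hd; pose Q : Fhom (Fsum X' Y) Y' := mkFhom (Y := Y') qd.
have uQ : E u Q by [].
exists Y', (Fcomp Q (Finl X' Y)), (Fcomp Q (Finr X' Y)); split; first split.
- apply: FhomP => x v; rewrite /= /rep_pair_fun /= /rep_pair_fun /=.
  by rewrite ri p0 !linear0 addr0 add0r.
- move=> W g h /FhomE/= gh.
  pose gg : Fhom (Fsum X' Y) W :=
    Fcomp (h : Fhom _ _) (Ffst X' Y) + Fcomp (g : Fhom _ _) (Fsnd X' Y).
  have gg0 : Fcomp gg u = 0.
    by apply: FhomP => x v; rewrite /= gh linearN addNr.
  have [_ /(_ W gg gg0)[k [/FhomE kQ k_uniq]]] := exact_is_cokernel uQ.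
  exists k; split=> [|k' [/FhomE k'f /FhomE k'i]].
    split; apply: FhomP => x v; apply: etrans (kQ x _) _.
      by rewrite /= linear0 add0r.
    by rewrite /= linear0 addr0.
  apply: k_uniq; apply: FhomP => x [a b].
  have ab : (a, b) = Finl X' Y x a + Finr X' Y x b.
    by congr pair; rewrite /= ?addr0 ?add0r.
  apply: etrans (congr1 (Fcomp k' Q x) ab) _; rewrite linearD [RHS]/=.
  by congr (_ + _); [exact: k'i | exact: k'f].
(* [snd] commutes with [d] because [snd Q = p snd] does and [Q] is onto. *)
- have snd_d x v : rep_snd X' (Z : Fobj) x (Fd Y' x v) =
      Fd (Z : Fobj) x (rep_snd X' (Z : Fobj) x v).
    have [_ _ /(_ x v)[y <-]] := uQ.
    by rewrite -Fhom_d /= Fhom_d.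
  exists Z, (mkFhom (X := Y') snd_d); split=> [x v w []|x [a c]|x c].
  + by rewrite /= !linear0 !addr0.
  + split=> [/= ->|[v ->]] /=.
      by exists a; rewrite /rep_pair_fun /= !linear0 addr0.
    by rewrite linear0.
  + by exists (0, c).
Qed.

(** The pullback is the kernel of [(y, z') |-> p y - f z'], which splitting [Y]
as [X + Z] identifies with [X + Z'], embedded by
[(a, z') |-> (i a + s (f z'), z')]. *)
Lemma adm_epi_pullback (Y Z Z' : Fobj) (p : Fhom Y Z) (f : Fhom Z' Z) :
  @adm_epi C E Y Z p ->
  exists (Y' : Fobj) (p' : Fhom Y' Z') (f' : Fhom Y' Y),
    @is_pullback C Y Z Y' Z' p f p' f' /\ @adm_epi C E Y' Z' p'.
Proof.
move=> [X [i ip]]; have p0 := short_exact0 ip.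
have [s [r [ps ri _ EE]]] := exact_split ip.
pose g : Fhom (Fsum Y Z') Z := Fcomp p (Ffst Y Z') - Fcomp f (Fsnd Y Z').
pose j : rep_hom (proj_sum (X : Fobj) Z') (Fsum Y Z') :=
  rep_pair (rep_copair (i : Fhom _ _) (rep_comp s f)) (rep_snd _ _).
have jg : rep_short_exact j g.
  case: ip => mi ex ep; split=> [x [a b] [a' b'] []|x [y z]|x z].
  - by move=> /= h hb; move: h; rewrite hb => /addIr/mi ->.
  - split=> [/= h|[[a b] [-> ->]]] /=.
      exists (r x y, z); congr pair => /=.
      by move/eqP: h; rewrite subr_eq0 => /eqP <-; rewrite -EE.
    by rewrite linearD p0 ps add0r subrr.
  - have [y hy] := ep x z.
    by exists (y, 0); rewrite /= linear0 subr0.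
have [d [hd jd]] := ker_d jg.
pose Y' := FObj hd; pose J : Fhom Y' (Fsum Y Z') := mkFhom (X := Y') jd.
have Jg : E J g by [].
exists Y', (Fcomp (Fsnd Y Z') J), (Fcomp (Ffst Y Z') J); split; first split.
- by apply: FhomP => x [a b]; rewrite /= linearD p0 ps add0r.
- move=> W u v /FhomE/= uv.
  have gw0 : Fcomp g (Fpair (u : Fhom _ _) (v : Fhom _ _)) = 0.
    by apply: FhomP => x w; rewrite /= uv subrr.
  have [_ /(_ W _ gw0)[k [/FhomE Jk k_uniq]]] := exact_is_kernel Jg.
  exists k; split=> [|k' [/FhomE k'u /FhomE k'v]].
    by split; apply: FhomP => x w; have [] := Jk x w.
  apply: k_uniq; apply: FhomP => x w.
  by rewrite [RHS]/= /rep_pair_fun -k'u -k'v.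
(* [inl] commutes with [d] because [J inl = inl i] does and [J] is injective. *)
- have inl_d x v : rep_inl (X : Fobj) Z' x (Fd (X : Fobj) x v) =
      Fd Y' x (rep_inl (X : Fobj) Z' x v).
    case: Jg => mJ _ _; apply: (mJ x).
    rewrite Fhom_d /= /rep_pair_fun /= /rep_pair_fun /= !linear0 !addr0.
    by rewrite Fhom_d.
  exists X, (mkFhom (Y := Y') inl_d); split=> [x v w []|x [a c]|x c] //.
  + split=> [/= ->|[v ->]] //=.
    by exists a.
  + by exists (0, c).
Qed.

Lemma Fpi_exact_category : exact_category E.
Proof.
split.
- exact: Fpi_additive.
- by move=> X Y Z i p ip; split;
    [exact: exact_is_kernel ip | exact: exact_is_cokernel ip].
- exact: Fpi_exact_iso.
- by move=> X; exists (Fzero K t), 0; apply: exact_id0.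
- by move=> X; exists (Fzero K t), 0; apply: exact_0id.
- exact: adm_mono_comp.
- exact: adm_epi_comp.
- exact: adm_mono_pushout.
- exact: adm_epi_pullback.
Qed.

(** * Projective and injective objects *)

(** By adjunction, lifting [f : double V -> Z] through [p] amounts to lifting
its restriction to the first summand as a morphism of representations, which a
section of [p] does. *)
Lemma double_projective (V : fg_proj K t) : @projective C E (double V).
Proof.
move=> Y Z p f [X [i ip]]; have [s [r [ps _ _ _]]] := exact_split ip.
exists (from_double (rep_comp s (rep_comp (f : Fhom _ _) (rep_inl V V)))).
apply: FhomP => x [a b].
rewrite /= linearD Fhom_d !ps -(@Fhom_d _ _ _ (double V) Z f) -linearD /=.
by congr ((f : Fhom (double V) Z) x (_, _));
  rewrite /= /rep_pair_fun /= ?scaler0 ?addr0 ?add0r.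
Qed.

(** By adjunction, extending [f : Y -> double V] along [i] amounts to extending
its second component as a morphism of representations, which a retraction of
[i] does. *)
Lemma double_injective (V : fg_proj K t) : @injective_object C E (double V).
Proof.
move=> Y Z i f [X [p ip]]; have [s [r [_ ri _ _]]] := exact_split ip.
exists (to_double (rep_comp (rep_snd V V) (rep_comp (f : Fhom _ _) r))).
apply: FhomP => x v.
rewrite /= /rep_pair_fun /= -Fhom_d !ri (@Fhom_d _ _ _ Y (double V) f).
by case: ((f : Fhom Y (double V)) x v).
Qed.

Lemma double_adm_epi (X : Fobj) :
  @adm_epi C E (double X) X (from_double (rep_id X)).
Proof.
exists (Fneg X), (to_double (X := Fneg X) (rep_id X)).
split=> [x v w []|x [a b]|x w] //.
  (* The kernel of [(a, b) |-> a + d b] is the set of all [(- d b, b)]. *)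
  split=> /= [/eqP|[v [-> ->]]]; last by rewrite addNr.
  by rewrite addr_eq0 => /eqP ->; exists b.
by exists (w, 0); rewrite /= linear0 addr0.
Qed.

Lemma double_adm_mono (X : Fobj) :
  @adm_mono C E X (double X) (to_double (rep_id X)).
Proof.
exists (Fneg X), (from_double (X := Fneg X) (rep_id X)).
split=> [x v w []|x [a b]|x w] //.
  (* The cokernel is the map [(a, b) |-> a - d b]. *)
  split=> /= [/eqP|[v [-> ->]]]; last by rewrite subrr.
  by rewrite subr_eq0 => /eqP ->; exists b.
by exists (w, 0); rewrite /= linear0 subr0.
Qed.

End Exactness.

Section Retracts.
Local Notation hom := Defs.hom.
Variables (C : preadditive) (E : forall X Y Z : C, hom X Y -> hom Y Z -> Prop).
Variables (X Y : C) (a : hom X Y) (b : hom Y X).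
Hypothesis ba : compm b a = idm X.

Lemma retract_projective : projective E Y -> projective E X.
Proof.
move=> pY U V p f ep; have [g hg] := pY _ _ p (compm f b) ep.
by exists (compm g a); rewrite compmA hg -compmA ba compm1.
Qed.

Lemma retract_injective : injective_object E Y -> injective_object E X.
Proof.
move=> iY U V i f mi; have [g hg] := iY _ _ i (compm a f) mi.
by exists (compm b g); rewrite -compmA hg compmA ba comp1m.
Qed.

End Retracts.

Theorem theorem2p1p3 (K : realType) (R : idomainType) (t : R)
    (dvrR : discrete_valuation_ring R) (ut : uniformizing_parameter t) :
  frobenius_category (@Fpi_exact K R t).
Proof.
split.
- exact: Fpi_exact_category.
- move=> X; exists (double (X : Fobj K t)), (from_double (rep_id _)).
  by split; [exact: double_projective | exact: double_adm_epi].
- move=> X; exists (double (X : Fobj K t)), (to_double (rep_id _)).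
  by split; [exact: double_injective | exact: double_adm_mono].
- move=> X; split=> hX.
    (* The identity of [X] lifts to a section of [double X -> X]. *)
    have [a ha] := hX _ _ _ (idm X) (double_adm_epi X).
    exact: retract_injective ha (@double_injective K R t (X : Fobj K t)).
  have [b hb] := hX _ _ _ (idm X) (double_adm_mono X).
  exact: retract_projective hb (@double_projective K R t (X : Fobj K t)).
Qed.
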